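(* The weight function $w_3(\lambda,x)=1-e^{-x/\lambda}$, $\lambda>0$, $x>0$, is $\mathrm{STP}_\infty$. More generally, for each nonnegative integer $k$ the weight function $$w_{3,k}(\lambda,x)=k!\Big[1-e^{-x/\lambda}\sum_{j=0}^k\frac{(x/\lambda)^j}{j!}\Big],\qquad \lambda>0,\ x>0,$$ is $\mathrm{STP}_\infty$.
   Context: A real function $w(\lambda,x)$ on $(0,\infty)\times(0,\infty)$ is $\mathrm{STP}_\infty$ (strictly totally positive of order infinity) if for every $r\ge 1$, all $\lambda_1>\cdots>\lambda_r>0$ and all $x_1>\cdots>x_r>0$, the $r\times r$ determinant $\det(w(\lambda_i,x_j))$ is $>0$. *)

(* Defs.v *)
From mathcomp Require Import all_boot all_order all_algebra.
From mathcomp Require Import reals sequences exp.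
Set Implicit Arguments.
Unset Strict Implicit.
Unset Printing Implicit Defensive.

Import Order.TTheory GRing.Theory Num.Theory.
Local Open Scope ring_scope.

(* Functions on (0,oo) x (0,oo) are represented by total functions R -> R -> R;
   only their values at positive arguments matter below. *)

Definition STP_infty (R : realType) (w : R -> R -> R) : Prop :=
  forall (r : nat) (lambda x : 'I_r -> R),
    (1 <= r)%N ->
    (forall i, 0 < lambda i) ->
    (forall i j : 'I_r, (i < j)%N -> lambda i > lambda j) ->
    (forall j, 0 < x j) ->
    (forall i j : 'I_r, (i < j)%N -> x i > x j) ->
    0 < \det (\matrix_(i < r, j < r) w (lambda i) (x j)).

Definition w3 (R : realType) (lambda x : R) : R := 1 - expR (- (x / lambda)).

Definition w3k (R : realType) (k : nat) (lambda x : R) : R :=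
  k`!%:R *
  (1 - expR (- (x / lambda)) * \sum_(0 <= j < k.+1) (x / lambda) ^+ j / j`!%:R).

(* Main.v *)
(* Put F(s) = w_{3,k} as a function of s = x / lambda; then F(0) = 0 and
   F'(s) = s^k e^(-s).  Adjoining the node x_{r+1} = 0, subtracting from each
   column of det F(x_j / lambda_i) its right neighbour, and applying the mean
   value theorem in each column turns the determinant into a positive multiple
   of det (e^(- t_j / lambda_i)) with interlacing nodes
   x_1 > t_1 > x_2 > t_2 > ... > 0.  Exponential determinants are positive by
   induction on their size, with the same column argument: after the last
   exponent is normalised to 0, the last row of the differenced matrix is
   (0, ..., 0, 1), and the remaining minor is again a positive multiple of an
   exponential determinant. *)

Require Import Defs.
From mathcomp Require Import all_boot all_order all_algebra.
From mathcomp Require Import reals sequences exp.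
From mathcomp Require Import boolp functions topology normedtype derive realfun.
From mathcomp Require Import ring.

Set Implicit Arguments.
Unset Strict Implicit.
Unset Printing Implicit Defensive.

Import Order.TTheory GRing.Theory Num.Theory.
Import numFieldNormedType.Exports.
Local Open Scope ring_scope.

(** Differencing the columns is right multiplication by a lower triangular matrix with unit
    diagonal. The last column has no right neighbour, so [g] must vanish at index [n]. *)
Lemma det_col_sub_next (R : comNzRingType) (n : nat) (g : 'I_n -> nat -> R) :
  (forall i, g i n = 0) ->
  \det (\matrix_(i < n, j < n) (g i j - g i j.+1)) =
  \det (\matrix_(i < n, j < n) g i j).
Proof.
move=> gn0.
pose U : 'M[R]_n := \matrix_(k, j) ((k == j)%:R - (k == j.+1 :> nat)%:R).
have -> : \matrix_(i < n, j < n) (g i j - g i j.+1) =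
          (\matrix_(i < n, j < n) g i j) *m U.
  apply/matrixP => i j; rewrite !mxE.
  under eq_bigr => k _ do rewrite !mxE mulrBr.
  rewrite big_split /= (bigD1 j) //= eqxx mulr1 big1 ?addr0; last first.
    by move=> k /negPf->; rewrite mulr0.
  congr (_ + _); rewrite sumrN; congr (- _).
  have [jn|nj] := ltnP j.+1 n.
    rewrite (bigD1 (Ordinal jn)) //= eqxx mulr1 big1 ?addr0// => k.
    by rewrite -val_eqE /= => /negPf->; rewrite mulr0.
  have -> : j.+1 = n by apply/eqP; rewrite eqn_leq nj ltn_ord.
  rewrite gn0 big1// => k _.
  by rewrite (ltn_eqF (ltn_ord k)) mulr0.
rewrite det_mulmx (@det_trig _ _ U); last first.
  apply/is_trig_mxP => i j ij; rewrite mxE -val_eqE /=.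
  by rewrite (ltn_eqF ij) ltn_eqF ?subr0// ltnS ltnW.
by rewrite big1 ?mulr1// => i _; rewrite mxE eqxx ltn_eqF ?subr0.
Qed.

Lemma det_scale (R : comNzRingType) (n : nat) (c d : 'I_n -> R)
    (A : 'I_n -> 'I_n -> R) :
  \det (\matrix_(i, j) (c i * A i j * d j)) =
  (\prod_i c i) * \det (\matrix_(i, j) A i j) * (\prod_j d j).
Proof.
have -> : \matrix_(i, j) (c i * A i j * d j) =
    diag_mx (\row_i c i) *m (\matrix_(i, j) A i j) *m diag_mx (\row_j d j).
  by apply/matrixP => i j; rewrite mul_mx_diag mul_diag_mx !mxE.
rewrite !det_mulmx !det_diag.
by congr (_ * _ * _); apply: eq_bigr => i _; rewrite mxE.
Qed.

(* The mean value theorem applied to one column at a time: a determinant is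
   affine in each column, so the cofactors of the column being changed are
   constants. *)
Lemma det_MVT (R : realType) (n : nat) (F F' : 'I_n -> R -> R)
    (a b : 'I_n -> R) :
  (forall i (t : R), is_derive t 1 (F i) (F' i t)) -> (forall j, a j < b j) ->
  exists2 t : 'I_n -> R, (forall j, a j < t j < b j) &
    \det (\matrix_(i, j) (F i (b j) - F i (a j))) =
    (\prod_j (b j - a j)) * \det (\matrix_(i, j) F' i (t j)).
Proof.
move=> dF ab.
(* Induction on the number [m] of columns already replaced by derivatives. *)
suff: forall m, (m <= n)%N ->
  exists2 t : 'I_n -> R, (forall j, a j < t j < b j) &
    \det (\matrix_(i, j) (F i (b j) - F i (a j))) =
    (\prod_(j < n | (j < m)%N) (b j - a j)) *
    \det (\matrix_(i, j) if (j < m)%N then F' i (t j)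
                         else F i (b j) - F i (a j)).
  move=> /(_ n (leqnn n))[t abt ->]; exists t => //.
  congr (_ * _); first by apply: eq_bigl => j; rewrite ltn_ord.
  by congr (\det _); apply/matrixP => i j; rewrite !mxE ltn_ord.
elim=> [_|m IH mn].
  (* Placeholders: at [m = 0] no column depends on [t] yet. *)
  exists (fun j => (a j + b j) / 2) => [j|].
    by rewrite !midf_lt ?ab.
  by rewrite big_pred0_eq mul1r.
have [t abt ->] := IH (ltnW mn).
pose j0 := Ordinal mn.
set A := \matrix_(i, j) if (j < m)%N then _ else _.
(* Expansion along column [j0]: [G (b j0) - G (a j0)] is [\det A]. *)
pose G s := \sum_i F i s * cofactor A i j0.
have dG (s : R) : is_derive s 1 G (\sum_i F' i s * cofactor A i j0).
  have -> : G = \sum_i (cofactor A i j0 \*: F i).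
    by apply/funext => u; rewrite fct_sumE; apply: eq_bigr => i _; rewrite mulrC.
  apply: is_derive_eq.
  by apply: eq_bigr => i _; rewrite /GRing.scale /= mulrC.
have [|c] := @MVT R G (fun s => \sum_i F' i s * cofactor A i j0) (a j0) (b j0) (ab j0).
  by apply: derivable_within_continuous => s _; have [] := dG s.
rewrite in_itv /= => abc Gc.
exists (fun j => if j == j0 then c else t j) => [j|]; first by case: eqP => [->|].
rewrite [in RHS](bigD1 j0) /=; last exact: ltnSn.
have -> : \det A = (\sum_i F' i c * cofactor A i j0) * (b j0 - a j0).
  rewrite -Gc -sumrB (expand_det_col A j0); apply: eq_bigr => i _.
  by rewrite [A i j0]mxE ltnn mulrBl.
have -> : \prod_(j < n | (j < m)%N) (b j - a j) =
          \prod_(j < n | (j < m.+1)%N && (j != j0)) (b j - a j).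
  apply: eq_bigl => j; rewrite -val_eqE /= ltnS.
  by case: ltngtP => // ->; rewrite andbF.
rewrite (expand_det_col _ j0) mulrCA [LHS]mulrC; congr (_ * _); first exact: mulrC.
apply: eq_bigr => i _; rewrite mxE ltnSn eqxx; congr (_ * (_ * _)); congr (\det _).
apply/matrixP => k l; rewrite !mxE.
have lj : lift j0 l != j0 by rewrite eq_sym neq_lift.
rewrite (negPf lj); move: lj; rewrite -val_eqE /= ltnS => lj.
by rewrite [in RHS]leq_eqVlt (negPf lj).
Qed.

Lemma det_expR_gt0 (R : realType) (n : nat) (mu t : 'I_n -> R) :
  (forall i j : 'I_n, (i < j)%N -> mu i > mu j) ->
  (forall i j : 'I_n, (i < j)%N -> t i > t j) ->
  0 < \det (\matrix_(i, j) expR (mu i * t j)).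
Proof.
elim: n mu t => [|n IH] mu t hmu ht; first by rewrite det_mx00.
pose nu i := mu i - mu ord_max.
have -> : \matrix_(i, j) expR (mu i * t j) =
          \matrix_(i, j) (1 * expR (nu i * t j) * expR (mu ord_max * t j)).
  by apply/matrixP => i j; rewrite !mxE mul1r -expRD -mulrDl subrK.
rewrite (det_scale (fun _ => 1)) big1// mul1r.
apply: mulr_gt0; last by apply: prodr_gt0 => j _; exact: expR_gt0.
(* The padding value 0 at index [n.+1] leaves the last column unchanged by differencing, so its
   entry in the last row stays 1. *)
pose g i (j : nat) := if (j < n.+1)%N then expR (nu i * t (inord j)) else 0.
have -> : \matrix_(i, j) expR (nu i * t j) = \matrix_(i, j < n.+1) g i j.
  by apply/matrixP => i j; rewrite !mxE /g ltn_ord inord_val.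
rewrite -det_col_sub_next => [|i]; last by rewrite /g ltnn.
have gmax j : (j < n.+1)%N -> g ord_max j = 1.
  by move=> jn; rewrite /g jn /nu subrr mul0r expR0.
rewrite (expand_det_row _ ord_max) (bigD1 ord_max)//= big1 ?addr0; last first.
  move=> j jmax; rewrite mxE !gmax ?subrr ?mul0r//.
  by rewrite ltnS ltn_neqAle -ltnS ltn_ord andbT; exact: jmax.
rewrite mxE gmax// {1}/g ltnn subr0 mul1r /cofactor -signr_odd oddD addbb mul1r.
have lmax (k : 'I_n) : lift ord_max k = k :> nat by rewrite lift_max.
pose b (j : 'I_n) := t (lift ord_max j); pose a (j : 'I_n) := t (lift ord0 j).
pose rho (i : 'I_n) := nu (lift ord_max i).
have -> : row' ord_max (col' ord_max (\matrix_(i, j < n.+1) (g i j - g i j.+1))) =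
          \matrix_(i, j) (expR (rho i * b j) - expR (rho i * a j)).
  apply/matrixP => i j; rewrite !mxE /g lmax ltnS [(j <= n)%N]ltnW// ltnS ltn_ord.
  by congr (expR (_ * t _) - expR (_ * t _)); apply: ord_inj;
    rewrite inordK ?lmax ?lift0 ?ltnS ?(ltnW (ltn_ord _)) ?ltn_ord.
have [||s abs ->] := @det_MVT R n (fun i s => expR (rho i * s))
    (fun i s => rho i * expR (rho i * s)) a b.
- move=> i s; apply: is_derive_eq.
  by rewrite /GRing.scale /=; ring.
- by move=> j; apply: ht; rewrite lmax lift0.
apply: mulr_gt0; first by apply: prodr_gt0 => j _; rewrite subr_gt0 ht// lmax lift0.
have -> : \matrix_(i, j) (rho i * expR (rho i * s j)) =
   \matrix_(i, j) (rho i * expR (rho i * s j) * 1).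
  by apply/matrixP => i j; rewrite !mxE mulr1.
rewrite (det_scale _ (fun _ => 1)) [X in _ * X]big1// mulr1.
apply: mulr_gt0.
  by apply: prodr_gt0 => i _; rewrite subr_gt0 hmu// lmax.
(* For [i < j] the nodes interlace: [s j < b j <= a i < s i], with equality in the middle when
   [j = i.+1]. *)
apply: IH => i j ij; first by rewrite ltrD2r hmu// !lmax.
have /andP[+ _] := abs i; apply: le_lt_trans.
have /andP[_ sj] := abs j; apply/ltW/(lt_le_trans sj).
rewrite /a /b; have [e|ne] := eqVneq i.+1 j.
  by rewrite (_ : lift ord0 i = lift ord_max j)//; apply: ord_inj; rewrite lmax lift0.
by apply/ltW/ht; rewrite lmax lift0 ltn_neqAle ne.
Qed.

(* The lower incomplete gamma function gamma(k + 1, s), the integral of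
   t^k e^(-t) over [0, s]. *)
Definition incomplete_gamma (R : realType) (k : nat) (s : R) : R :=
  k`!%:R * (1 - expR (- s) * \sum_(0 <= j < k.+1) s ^+ j / j`!%:R).

Lemma incomplete_gamma0 (R : realType) (k : nat) :
  incomplete_gamma k (0 : R) = 0.
Proof.
rewrite /incomplete_gamma big_nat_recl// expr0 fact0 divr1 big1 => [|j _].
  by rewrite addr0 oppr0 expR0 mulr1 subrr mulr0.
by rewrite expr0n mul0r.
Qed.

(** This is integration by parts; algebraically, it splits off the last term of the sum. *)
Lemma incomplete_gammaS (R : realType) (k : nat) (s : R) :
  incomplete_gamma k.+1 s =
  k.+1%:R * incomplete_gamma k s - s ^+ k.+1 * expR (- s).
Proof.
rewrite /incomplete_gamma (big_nat_recr k.+1)//= factS natrM.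
have k0 : k`!%:R != 0 :> R by rewrite pnatr_eq0 -lt0n fact_gt0.
by field; rewrite k0 nat1r pnatr_eq0.
Qed.

(** By induction on [k]: on differentiating the recurrence, the two terms in [s ^+ k] cancel. *)
Lemma is_derive_incomplete_gamma (R : realType) (k : nat) (s : R) :
  is_derive s 1 (@incomplete_gamma R k) (s ^+ k * expR (- s)).
Proof.
elim: k => [|k IH].
  have -> : @incomplete_gamma R 0 = (fun s => 1 - expR (- s)).
    by apply/funext => u; rewrite /incomplete_gamma big_nat1 fact0 divr1 mul1r mulr1.
  by apply: is_derive_eq; rewrite /GRing.scale /=; ring.
have -> : @incomplete_gamma R k.+1 =
    k.+1%:R \*: @incomplete_gamma R k - (@id R) ^+ k.+1 * (expR \o -%R).
  by apply/funext => u; rewrite incomplete_gammaS /= !fctE.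
have dN : is_derive s 1 (expR \o @GRing.opp R) (expR (- s) * -1).
  exact: is_derive1_comp.
by apply: is_derive_eq; rewrite ?fctE /GRing.scale /=; ring.
Qed.

Lemma STP_incomplete_gamma (R : realType) (k : nat) :
  STP_infty (fun lambda x : R => incomplete_gamma k (x / lambda)).
Proof.
move=> [//|n] lambda x _ lambda0 hlambda x0 hx.
pose X (j : nat) := if (j < n.+1)%N then x (inord j) else 0.
have XE (j : 'I_n.+1) : X j = x j by rewrite /X ltn_ord inord_val.
(* Only [i] is bounded: [j] may be the adjoined node, where [X] is 0. *)
have hX (i j : nat) : (i < n.+1)%N -> (i < j)%N -> X j < X i.
  move=> iltn ij; rewrite /X iltn; case: ifP => // jn.
  by apply: hx; rewrite !inordK.
pose F i s := incomplete_gamma k (s / lambda i).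
have -> : \matrix_(i, j) incomplete_gamma k (x j / lambda i) =
          \matrix_(i < n.+1, j < n.+1) F i (X j).
  by apply/matrixP => i j; rewrite !mxE XE.
rewrite -(det_col_sub_next (g := fun i j => F i (X j))) => [|i]; last first.
  by rewrite /F /X ltnn mul0r incomplete_gamma0.
have [||t Xt ->] := @det_MVT R n.+1 F
    (fun i s => (s / lambda i) ^+ k * expR (- (s / lambda i)) / lambda i)
    (fun j => X j.+1) (fun j => X j).
- move=> i s; rewrite /F.
  apply: (@is_derive1_comp R (@incomplete_gamma R k) (fun s => s / lambda i)).
    exact: is_derive_incomplete_gamma.
  by apply: is_derive_eq; rewrite /GRing.scale /=; ring.
- by move=> j; apply: hX.
apply: mulr_gt0; first by apply: prodr_gt0 => j _; rewrite subr_gt0 hX.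
have X0 j : 0 <= X j by rewrite /X; case: ifP => // _; exact/ltW.
(* Row and column factors separate, leaving the exponents [- (lambda i)^-1], which decrease in [i]
   because [lambda] does. *)
have -> : \matrix_(i, j) ((t j / lambda i) ^+ k * expR (- (t j / lambda i)) / lambda i) =
    \matrix_(i, j) ((lambda i)^-1 ^+ k.+1 * expR (- (lambda i)^-1 * t j) * t j ^+ k).
  apply/matrixP => i j; rewrite !mxE exprS exprMn.
  by rewrite (_ : - (t j / _) = - (lambda i)^-1 * t j); ring.
rewrite (det_scale _ (fun j => t j ^+ k)).
apply: mulr_gt0; last first.
  apply: prodr_gt0 => j _; apply: exprn_gt0.
  by have /andP[+ _] := Xt j; exact: le_lt_trans.
apply: mulr_gt0.
  by apply: prodr_gt0 => i _; rewrite exprn_gt0// invr_gt0.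
apply: det_expR_gt0 => i j ij; first by rewrite ltrN2 ltf_pV2 ?posrE// hlambda.
have /andP[+ _] := Xt i; apply: le_lt_trans.
have /andP[_ tj] := Xt j; apply/ltW/(lt_le_trans tj).
have [->//|ne] := eqVneq i.+1 j; apply/ltW/hX.
  exact: leq_ltn_trans ij (ltn_ord j).
by rewrite ltn_neqAle ne.
Qed.

Theorem mainTheorem6 (R : realType) :
  STP_infty (@w3 R) /\ (forall k : nat, STP_infty (@w3k R k)).
Proof.
(* [w3k] unfolds to [incomplete_gamma] at [x / lambda]; [w3] is the case [k = 0] after simplifying
   the one-term sum. *)
split=> [|k]; last exact: STP_incomplete_gamma.
have -> : @w3 R = fun lambda x => incomplete_gamma 0 (x / lambda).
  apply/funext => lambda; apply/funext => x.
  by rewrite /incomplete_gamma /w3 big_nat1 fact0 divr1 mul1r mulr1.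
exact: STP_incomplete_gamma.
Qed.
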